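(* Assume that for every customer $k$ and any two applications $a\ne a'$, the complements of $\mathcal{I}_k^a$ and $\mathcal{I}_k^{a'}$ in $[T]$ are disjoint. Then the provider's bilevel problem (described in the context) can be solved by the following steps. 1. Find an optimal solution $((N^{a,b})^* )_{a\in[A],b\in[B]}$ of $$\max_{N^{a,b}\in\sum_{k\in\mathcal{K}^b}F_k^a}\ \sum_{t,l}\Big(\sum_{a\in[A]}\sum_{b\in[B]}\gamma_b N^{a,b}(t,l)\,s_l^{a,b}(N(t,l))\Big)$$ subject to $N(t,l)=\sum_{a}\sum_{b}N^{a,b}(t,l)$ and $N(t,l)\le N_l^C$ for all $(t,l)\in[T]\times[L]$. 2. For each $a\in[A]$, $b\in[B]$, find an optimal solution $((u_k^a)^* )_{k\in\mathcal{K}^b}$ of $$\max\Big\{\sum_{k\in\mathcal{K}^b}\langle\rho_k^a,u_k^a\rangle : u_k^a\in F_k^a\ \forall k\in\mathcal{K}^b,\ \sum_{k\in\mathcal{K}^b}u_k^a=(N^{a,b})^*\Big\}.$$ 3. For each $a\in[A]$, $b\in[B]$, find a vector $y_{a,b}^*$ such that for every $k\in\mathcal{K}^b$, $(u_k^a)^*\in\arg\max_{u_k^a\in F_k^a}\langle\rho_k^a+y_{a,b}^*,u_k^a\rangle$. That is: for any optimal solution of step 1, step 2 has an optimal solution; for any optimal solution of step 2, vectors $y_{a,b}^*\in\mathbb{R}_+^{T\times L}$ as in step 3 exist; and any such nonnegative vectors (with the responses $(u_k^a)^*$) form an optimal solution of the bilevel problem.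
   Context: $[m]=\{1,\dots,m\}$. There are $T$ time slots, $L$ cells, $K$ customers, $A$ applications, $B$ types of contracts; $\mathcal{K}^b\subset[K]$ is the set of customers with contract $b$ (these sets partition $[K]$). Customer $k$ has trajectory $(L_1^k,\dots,L_T^k)\in[L]^T$, preferences $\rho_k^a(t)\in\mathbb{R}$, sensitivities $\alpha_k^a>0$, request numbers $R_k^a\in\{0,\dots,T\}$ and forbidden sets $\mathcal{I}_k^a\subset[T]$. Numbers $\gamma_b>0$, integers $N_l^C\geq 0$ and satisfaction functions $s_l^{a,b}$ (nonincreasing, concave on $[0,N_l^C]$) are given. Bilevel problem: given discounts $y^{a,b}\in\mathbb{R}_+^{T\times L}$, customer $k\in\mathcal{K}^b$ chooses $(u_k^a)_{a}\in(\{0,1\}^T)^A$ maximizing $\sum_a\sum_{t}[\rho_k^a(t)+\alpha_k^a y^{a,b}(t,L_t^k)]u_k^a(t)$ subject to $\sum_t u_k^a(t)=R_k^a$ for all $a$, $\sum_a u_k^a(t)\le 1$ for all $t$, and $u_k^a(t)=0$ for $t\in\mathcal{I}_k^a$. The provider maximizes over $y^{a,b}\in\mathbb{R}_+^{T\times L}$ the quantity $\sum_{t,l}\sum_{a,b}\gamma_b N^{a,b}(t,l)s_l^{a,b}(N(t,l))$ subject to $N(t,l)\le N_l^C$ for all $t,l$, where $N^{a,b}(t,l)=\sum_{k\in\mathcal{K}^b}u_k^a(t)\mathbf{1}(L_t^k=l)$, $N=\sum_{a,b}N^{a,b}$, and the $u_k^a$ are customers' optimal responses (if not unique, their choice is part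 of the optimization). Notation in the steps: a consumption $u_k^a\in\{0,1\}^T$ is identified with the vector $u_k^a(t,l)=u_k^a(t)\mathbf{1}(L_t^k=l)$ of $\{0,1\}^{T\times L}$. Put $\mathcal{J}_k^a=\{(t,l): t\in\mathcal{I}_k^a\text{ or }l\ne L_t^k\}$, $F_k^a=\{u\in\{0,1\}^{T\times L}:\sum_{t,l}u(t,l)=R_k^a,\ u(t,l)=0\ \forall(t,l)\in\mathcal{J}_k^a\}$, and $\rho_k^a(t,l)=\rho_k^a(t)/\alpha_k^a$ if $(t,l)\notin\mathcal{J}_k^a$, $-\infty$ otherwise, with $(-\infty)\cdot 0=0$ in scalar products. *)

(* Defs.v *)
From mathcomp Require Import all_boot all_order all_algebra.
From mathcomp Require Import classical_sets reals ereal convex.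

Set Implicit Arguments.
Unset Strict Implicit.
Unset Printing Implicit Defensive.

Import Order.TTheory GRing.Theory Num.Theory.
Local Open Scope ring_scope.

Definition optimal d (V : porderType d) (X : Type)
    (feasible : X -> Prop) (objective : X -> V) (x : X) : Prop :=
  feasible x /\ forall x', feasible x' -> (objective x' <= objective x)%O.

(* The sets K^b partition the customers, so they are given by the map
   [contract]; the index sets [T], [L], [K], [A], [B] are ordinals.  The
   satisfaction functions matter only on [0, N_l^C], and both monotonicity
   and concavity are required there only. *)
Record pricing_data (R : realType) (T L K A B : nat) := PricingData {
  contract : 'I_K -> 'I_B ;
  traj : 'I_K -> 'I_T -> 'I_L ;
  pref : 'I_K -> 'I_A -> 'I_T -> R ;
  sens : 'I_K -> 'I_A -> R ;
  request : 'I_K -> 'I_A -> 'I_T.+1 ;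
  forbidden : 'I_K -> 'I_A -> {set 'I_T} ;
  gamma : 'I_B -> R ;
  capacity : 'I_L -> nat ;
  satisf : 'I_L -> 'I_A -> 'I_B -> R -> R ;
  sens_gt0 : forall k a, 0 < sens k a ;
  gamma_gt0 : forall b, 0 < gamma b ;
  satisf_nonincreasing : forall l a b,
    {in `[0, (capacity l)%:R] &, {homo satisf l a b : x y /~ x <= y}} ;
  satisf_concave : forall l a b,
    @convex_function R R^o `[0 : R, (capacity l)%:R]%classic
      (fun x => - satisf l a b x)
}.

Section Pricing.
Variables (R : realType) (T L K A B : nat).
Variable P : pricing_data R T L K A B.

Definition customers (b : 'I_B) : {set 'I_K} := [set k | contract P k == b].

(* A consumption u(t) seen as the element u(t) 1(L_t^k = l) of {0,1}^(T x L). *)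
Definition embed (k : 'I_K) (u : {ffun 'I_T -> bool}) : 'M[bool]_(T, L) :=
  \matrix_(t, l) (u t && (traj P k t == l)).

Definition aggregate (b : 'I_B) (u : 'I_K -> 'M[bool]_(T, L)) :
    'M[nat]_(T, L) :=
  \matrix_(t, l) (\sum_(k in customers b) u k t l)%N.

Definition total_count (N : 'I_A -> 'I_B -> 'M[nat]_(T, L)) (t : 'I_T) (l : 'I_L) :
    nat := (\sum_(a < A) \sum_(b < B) N a b t l)%N.

Definition within_capacity (N : 'I_A -> 'I_B -> 'M[nat]_(T, L)) : Prop :=
  forall t l, (total_count N t l <= capacity P l)%N.

Definition provider_value (N : 'I_A -> 'I_B -> 'M[nat]_(T, L)) : R :=
  \sum_(t < T) \sum_(l < L) \sum_(a < A) \sum_(b < B)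
    gamma P b * (N a b t l)%:R * satisf P l a b (total_count N t l)%:R.

(* Bilevel problem.  In the lower level, y a is the discount matrix offered
   for application a to the contract of customer k. *)
Definition customer_feasible (k : 'I_K) (u : 'I_A -> {ffun 'I_T -> bool}) :
    Prop :=
  [/\ forall a, (\sum_(t < T) u a t)%N = request P k a,
      forall t : 'I_T, (\sum_(a < A) u a t <= 1)%N
    & forall a t, t \in forbidden P k a -> u a t = false].

Definition customer_value (k : 'I_K) (y : 'I_A -> 'M[R]_(T, L))
    (u : 'I_A -> {ffun 'I_T -> bool}) : R :=
  \sum_(a < A) \sum_(t < T)
    (pref P k a t + sens P k a * y a t (traj P k t)) * (u a t)%:R.

Definition nonneg (y : 'M[R]_(T, L)) : Prop := forall t l, 0 <= y t l.

Definition consumption_counts (u : 'I_K -> 'I_A -> {ffun 'I_T -> bool})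
    (a : 'I_A) (b : 'I_B) : 'M[nat]_(T, L) :=
  aggregate b (fun k => embed k (u k a)).

(* The responses are decision variables of the provider, constrained to be
   optimal for the customers: this is the optimistic bilevel problem. *)
Definition bilevel_feasible
    (yu : ('I_A -> 'I_B -> 'M[R]_(T, L)) *
          ('I_K -> 'I_A -> {ffun 'I_T -> bool})) : Prop :=
  [/\ forall a b, nonneg (yu.1 a b),
      forall k, optimal (customer_feasible k)
        (customer_value k (fun a => yu.1 a (contract P k))) (yu.2 k)
    & within_capacity (consumption_counts yu.2)].

Definition bilevel_optimal (y : 'I_A -> 'I_B -> 'M[R]_(T, L))
    (u : 'I_K -> 'I_A -> {ffun 'I_T -> bool}) : Prop :=
  optimal bilevel_feasible
    (fun yu => provider_value (consumption_counts yu.2)) (y, u).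

Definition J (k : 'I_K) (a : 'I_A) : {set 'I_T * 'I_L} :=
  [set p | (p.1 \in forbidden P k a) || (p.2 != traj P k p.1)].

Definition F (k : 'I_K) (a : 'I_A) : {set 'M[bool]_(T, L)} :=
  [set u : 'M[bool]_(T, L) |
    (\sum_(t < T) \sum_(l < L) u t l == request P k a)%N &&
    [forall p in J k a, u p.1 p.2 == false]].

Definition rho (k : 'I_K) (a : 'I_A) (t : 'I_T) (l : 'I_L) : \bar R :=
  if (t, l) \notin J k a then (pref P k a t / sens P k a)%:E else -oo%E.

(* In \bar R, (-oo) * 0 = 0. *)
Definition scalar_product (c : 'I_T -> 'I_L -> \bar R) (u : 'M[bool]_(T, L)) :
    \bar R :=
  (\sum_(t < T) \sum_(l < L) c t l * ((u t l)%:R)%:E)%E.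

Definition in_Minkowski_sum (a : 'I_A) (b : 'I_B) (N : 'M[nat]_(T, L)) : Prop :=
  exists2 u : 'I_K -> 'M[bool]_(T, L),
    (forall k, k \in customers b -> u k \in F k a) & N = aggregate b u.

Definition step1_optimal (N : 'I_A -> 'I_B -> 'M[nat]_(T, L)) : Prop :=
  optimal
    (fun M => (forall a b, in_Minkowski_sum a b (M a b)) /\ within_capacity M)
    provider_value N.

(* Only the values u k with k in K^b are relevant. *)
Definition step2_optimal (a : 'I_A) (b : 'I_B) (N : 'M[nat]_(T, L))
    (u : 'I_K -> 'M[bool]_(T, L)) : Prop :=
  optimal
    (fun v : 'I_K -> 'M[bool]_(T, L) =>
      (forall k, k \in customers b -> v k \in F k a) /\ aggregate b v = N)
    (fun v => (\sum_(k in customers b) scalar_product (rho k a) (v k))%E) u.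

Definition step3_solution (a : 'I_A) (b : 'I_B) (u : 'I_K -> 'M[bool]_(T, L))
    (y : 'M[R]_(T, L)) : Prop :=
  forall k, k \in customers b ->
    optimal (fun v => v \in F k a)
      (scalar_product (fun t l => (rho k a t l + (y t l)%:E)%E)) (u k).

End Pricing.

(* Main.v *)
Require Import Defs.
From mathcomp Require Import all_boot all_order all_algebra.
From mathcomp Require Import reals ereal.

Set Implicit Arguments.
Unset Strict Implicit.
Unset Printing Implicit Defensive.

Import Order.TTheory GRing.Theory Num.Theory.
Local Open Scope ring_scope.

(* Disjointness of the allowed times makes a customer's problem split over the
   applications, so every bilevel feasible point yields counts feasible in
   step 1, which is therefore an upper bound.  Conversely, the counts found in
   step 1 are implementable by prices: a step 2 optimum admits no improving
   cyclic exchange between customers, i.e. the graph of unit transfers has no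
   negative cycle, so its shortest path potentials exist, and as prices they
   make each customer's consumption optimal, since local exchanges suffice for
   optimality over sets of prescribed cardinality.  A constant may be added to
   prices because this cardinality is fixed, so they can be made nonnegative. *)

(** * Potentials in a weighted digraph without negative cycles *)

Section Potentials.
Variables (R : realDomainType) (V : finType).
Implicit Types (e : rel V) (w : V -> V -> R).

Fixpoint path_weight w (x : V) (s : seq V) : R :=
  if s is y :: s' then w x y + path_weight w y s' else 0.

Lemma path_weight_cat w x s1 s2 :
  path_weight w x (s1 ++ s2) =
  path_weight w x s1 + path_weight w (last x s1) s2.
Proof. by elim: s1 x => [|y s1 IH] x /=; rewrite ?add0r // IH addrA. Qed.

Definition seq_weight w (s : seq V) : R :=
  if s is x :: s' then path_weight w x s' else 0.

Lemma seq_weight_cat w s1 x s2 :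
  seq_weight w (s1 ++ x :: s2) =
  seq_weight w (rcons s1 x) + path_weight w x s2.
Proof.
case: s1 => [|y s1] /=; first by rewrite add0r.
by rewrite -cats1 -cat_rcons cats1 path_weight_cat last_rcons.
Qed.

(** The closing point [x0] is kept apart from the start [x] for the sake of the induction; [x0 := x]
    gives the weight of a cycle as a sum over [next]. *)
Lemma path_weight_next w x0 x s : uniq (x :: s) ->
  path_weight w x (rcons s x0) =
  \sum_(p <- x :: s) w p (next_at p x0 x s).
Proof.
elim: s x => [|y s IH] x; first by rewrite big_seq1 /= eqxx addr0.
case/andP=> xs us; rewrite big_cons [next_at _ _ _ _]/= eqxx /=.
congr (_ + _); rewrite IH //; apply: eq_big_seq => p ps.
by case: eqVneq => // px; rewrite -px ps in xs.
Qed.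

(* The potential of q is the least weight of a simple path ending at q. *)
Lemma potential_exists e w :
  (forall c, uniq c -> cycle e c -> 0 <= \sum_(p <- c) w p (next c p)) ->
  exists y : V -> R, (forall p, 0 <= y p) /\
    forall p q, e p q -> y q <= y p + w p q.
Proof.
move=> cycle_ge0.
pose to q s := uniq (rcons s q) && sorted e (rcons s q).
have shortest q : exists s, to q s /\
    forall s', to q s' -> seq_weight w (rcons s q) <= seq_weight w (rcons s' q).
  (* A simple path has at most [#|V|] vertices, so the minimum is taken over a finite type; the
     empty sequence stands for the path reduced to [q]. *)
  pose b0 : {bseq #|V| of V} := [bseq].
  pose tob (b : {bseq #|V| of V}) := to q b.
  have b0P : tob b0 by [].
  case: (arg_minP (fun b : {bseq #|V| of V} => seq_weight w (rcons b q)) b0P).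
  move=> b bP bmin; exists b; split=> // s' s'P.
  have sz : (size s' <= #|V|)%N.
    case/andP: s'P => us _; rewrite ltnW // -(size_rcons s' q).
    by rewrite -(card_uniqP us) max_card.
  exact: (bmin (Bseq sz)).
have [s sP] := fin_all_exists shortest.
pose d q := seq_weight w (rcons (s q) q).
(* Shifting by a bound on all [|d p|] gives nonnegativity and keeps the differences of [d]. *)
pose M := \sum_p `|d p|.
exists (fun p => d p + M); split=> [p|p q epq].
  rewrite /M (bigD1 p) //= addrA addr_ge0 ?sumr_ge0 //.
  by rewrite -lerBlDl sub0r -normrN ler_norm.
rewrite addrAC lerD2r.
have [/andP[us ss] _] := sP p; have [_ dmin] := sP q.
(* If the shortest path to [p] already visits [q], its part from [q] on closes along the edge from
   [p] to [q] into a cycle of nonnegative weight, and its part up to [q] gives the bound. Otherwise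
   the path extended by [q] is simple. *)
have [qr|qr] := boolP (q \in rcons (s p) p).
  case: {-1}_ / (splitPr qr) (erefl (rcons (s p) p)) => r1 r2 def_r.
  have lastp : last q r2 = p.
    by rewrite -(last_rcons q (s p) p) def_r last_cat.
  move: us ss; rewrite def_r => us ss.
  have to1 : to q r1.
    move: us ss; rewrite -cat_rcons /to cat_uniq => /andP[-> _] /=.
    by case: (rcons r1 q) => //= z r; rewrite cat_path => /andP[].
  have u2 : uniq (q :: r2) by move: us; rewrite cat_uniq => /and3P[].
  have c2 : cycle e (q :: r2).
    rewrite /= rcons_path lastp epq andbT.
    by move: ss; case: (r1) => [|z r] //=; rewrite cat_path /= => /and3P[].
  have := cycle_ge0 _ u2 c2; rewrite -path_weight_next //.
  rewrite -cats1 path_weight_cat /= addr0 lastp => cyc.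
  rewrite (le_trans (dmin _ to1)) // /d def_r seq_weight_cat -addrA.
  by rewrite lerDl.
have to2 : to q (rcons (s p) p).
  rewrite /to rcons_uniq qr us /=; move: ss.
  by case: (s p) => [|z r] /=; rewrite ?epq // !rcons_path last_rcons epq => ->.
rewrite (le_trans (dmin _ to2)) // /d.
by rewrite -[X in rcons X q]cats1 -cats1 -catA /= seq_weight_cat /= addr0.
Qed.

End Potentials.

(** * Exchange arguments and supporting prices *)

Section Prices.
Variables (R : realDomainType) (V I : finType).

(** Common elements cancel and the two differences have equal size; the least value of [f] on
    [X :\: Y] separates the remaining sums. *)
Lemma ler_sum_exchange (f : V -> R) (X Y : {set V}) :
  #|X| = #|Y| ->
  (forall p q, p \in X -> q \in Y -> q \notin X -> f q <= f p) ->
  \sum_(q in Y) f q <= \sum_(p in X) f p.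
Proof.
move=> cardXY fXY.
rewrite (big_setID X) [leRHS](big_setID Y) /= setIC lerD2l.
have cardD : #|X :\: Y| = #|Y :\: X|.
  by apply/eqP; rewrite -(eqn_add2l #|X :&: Y|) cardsID setIC cardsID cardXY.
have [X0|[p0 p0P]] := set_0Vmem (X :\: Y).
  by rewrite X0 cards0 in cardD; rewrite X0 (cards0_eq (esym cardD)).
case: (arg_minP f p0P) => p pP pmin.
apply: (@le_trans _ _ (f p *+ #|Y :\: X|)).
  rewrite -sumr_const; apply: ler_sum => q /setDP[qY qX].
  by case/setDP: pP => pX _; apply: fXY.
by rewrite -cardD -sumr_const; apply: ler_sum.
Qed.

Variables (D : {set I}) (allowed : I -> {set V}) (c : I -> V -> R).

(* Transferring one unit of agent i from p to q costs c i p - c i q.  By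
   optimality no cycle of transfers has negative cost, and a potential for the
   cheapest transfers is a price system. *)
Lemma supporting_prices (u : I -> {set V}) :
  (forall i, i \in D -> u i \subset allowed i) ->
  (forall v : I -> {set V},
     (forall i, i \in D -> v i \subset allowed i /\ #|v i| = #|u i|) ->
     (forall p, \sum_(i in D) (p \in v i) = \sum_(i in D) (p \in u i))%N ->
     \sum_(i in D) \sum_(p in v i) c i p <=
     \sum_(i in D) \sum_(p in u i) c i p) ->
  exists y : V -> R, (forall p, 0 <= y p) /\
    forall i (v : {set V}), i \in D -> v \subset allowed i -> #|v| = #|u i| ->
      \sum_(p in v) (c i p + y p) <= \sum_(p in u i) (c i p + y p).
Proof.
move=> u_allowed u_opt.
pose valid i (pq : V * V) :=
  [&& i \in D, pq.1 \in u i, pq.2 \notin u i & pq.2 \in allowed i].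
pose cost i (pq : V * V) := c i pq.1 - c i pq.2.
have cheapest pq : exists o, if o is Some i
    then valid i pq /\ forall j, valid j pq -> cost i pq <= cost j pq
    else forall j, ~~ valid j pq.
  have [i0 vi0|none] := pickP (fun i => valid i pq); last first.
    by exists None => j; rewrite none.
  case: (@arg_minP _ _ _ i0 (valid^~ pq) (cost^~ pq) vi0) => i vi imin.
  by exists (Some i).
have [k kP] := fin_all_exists cheapest.
pose e p q := k (p, q) : bool.
pose w p q := if k (p, q) is Some i then cost i (p, q) else 0.
(* The potential inequality for the cheapest agent implies it for every agent able to make the
   transfer, so no single exchange improves. What remains is the weight of a cycle. *)
have [cyc uc cc|y [y_ge0 yP]] := @potential_exists R V e w; last first.
  exists y; split=> // i v iD va card_v; apply: ler_sum_exchange => //.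
  move=> p q pu qv qu.
  have vi : valid i (p, q) by rewrite /valid iD pu qu (subsetP va).
  have := kP (p, q); have := yP p q; rewrite /e /w.
  case: (k _) => [j /(_ isT) yj [_ /(_ i vi)]|_ /(_ i)]; last by rewrite vi.
  rewrite -(lerD2l (y p)) => /(le_trans yj); rewrite /cost /=.
  by rewrite addrA lerBrDr [y q + _]addrC [y p + _]addrC.
(* All transfers of the cycle are carried out at once: the cheapest agent for the edge leaving [p]
   gives up [p] and receives [next cyc p]. *)
pose out i p := (p \in cyc) && (k (p, next cyc p) == Some i).
pose inn i p := out i (prev cyc p).
have outP i p : out i p -> valid i (p, next cyc p).
  by case/andP=> _ /eqP kE; have := kP (p, next cyc p); rewrite kE => -[].
have innP i p : inn i p -> valid i (prev cyc p, p).
  by move/outP; rewrite next_prev.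
pose v i := [set p | (p \in u i) && ~~ out i p || inn i p].
(* [out i p] needs [p] in [u i] and [inn i p] needs it outside, so they exclude each other. The
   additive form avoids truncated subtraction. *)
have vE i p : ((p \in v i) + out i p = (p \in u i) + inn i p)%N.
  rewrite inE; have := @outP i p; have := @innP i p; rewrite /valid /=.
  case: (inn i p) (out i p) (p \in u i) => -[] [] //= h1 h2;
    by [move: (h1 isT); rewrite ?andbF | move: (h2 isT); rewrite ?andbF].
have sum_inn i (g : V -> R) :
    \sum_p (inn i p)%:R * g p = \sum_p (out i p)%:R * g (next cyc p).
  (* [next cyc] permutes all of [V], being the identity off the cycle. *)
  rewrite (reindex (next cyc)) /=; last first.
    by apply: onW_bij; exists (prev cyc) => x; rewrite ?prev_next ?next_prev.
  by apply: eq_bigr => p _; rewrite /inn prev_next.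
have setE (X : {set V}) (g : V -> R) :
    \sum_(p in X) g p = \sum_p (p \in X)%:R * g p.
  by rewrite big_mkcond; apply: eq_bigr => p _; rewrite -mulrb mulr_natl.
have sum_v i (g : V -> R) : \sum_(p in v i) g p = \sum_(p in u i) g p
    - \sum_p (out i p)%:R * (g p - g (next cyc p)).
  have -> : \sum_p (out i p)%:R * (g p - g (next cyc p)) =
            \sum_p (out i p)%:R * g p - \sum_p (inn i p)%:R * g p.
    by rewrite sum_inn -sumrB; apply: eq_bigr => p _; rewrite mulrBr.
  rewrite !setE -!sumrB; apply: eq_bigr => p _; rewrite -!mulrBl.
  congr (_ * _); have /(congr1 (GRing.natmul (1 : R))) := vE i p.
  by rewrite !natrD opprB addrA => <-; rewrite addrK.
have kcyc p : p \in cyc -> exists2 i, i \in D & k (p, next cyc p) = Some i.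
  move=> pc; have := next_cycle cc pc; rewrite /e.
  have := outP^~ p; rewrite /out pc.
  case: (k _) => // i /(_ i); rewrite eqxx => /(_ isT)/andP[iD _] _.
  by exists i.
have sum_out p : (\sum_(i in D) out i p = (p \in cyc))%N.
  have [pc|pc] := boolP (p \in cyc); last first.
    by rewrite big1 // => i _; rewrite /out (negPf pc).
  have [i iD ki] := kcyc p pc.
  rewrite (bigD1 i) //= /out pc ki eqxx big1 // => j /andP[_ ji].
  by rewrite (inj_eq (@Some_inj _)) eq_sym (negPf ji).
have v_allowed i : i \in D -> v i \subset allowed i /\ #|v i| = #|u i|.
  move=> iD; split.
    apply/subsetP => p; rewrite inE => /orP[/andP[pu _]|/innP/and4P[]//].
    exact: (subsetP (u_allowed i iD)).
  (* Cardinality is [sum_v] for the constant function 1, whose transfer costs vanish. *)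
  apply/eqP; rewrite -(eqr_nat R) -!sumr_const sum_v.
  by rewrite [X in _ - X]big1 ?subr0 // => p _; rewrite subrr mulr0.
have v_sum p : (\sum_(i in D) (p \in v i) = \sum_(i in D) (p \in u i))%N.
  apply/eqP; rewrite -(eqn_add2r (\sum_(i in D) out i p)%N).
  rewrite -big_split (eq_bigr _ (fun i _ => vE i p)) big_split /=.
  by rewrite /inn !sum_out mem_prev.
(* Optimality makes the total cost of the transfers nonnegative; as each vertex of the cycle is
   given up by exactly one agent, this total is the weight of the cycle. *)
have := u_opt v v_allowed v_sum.
under eq_bigr do rewrite sum_v.
rewrite sumrB lerBlDr lerDl exchange_big /=; congr (0 <= _).
rewrite (bigID (mem cyc)) /= [X in _ + X]big1 ?addr0; last first.
  by move=> p pc; rewrite big1 // => i _; rewrite /out (negPf pc) mul0r.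
rewrite [RHS]big_uniq //; apply: eq_bigr => p pc.
have [i iD ki] := kcyc p pc; rewrite /w ki (bigD1 i) //=.
rewrite /out pc ki eqxx big1 ?mul1r ?addr0 // => j /andP[_ ji].
by rewrite (inj_eq (@Some_inj _)) eq_sym (negPf ji) mul0r.
Qed.

End Prices.

(** * Consumptions as sets of time-cell pairs *)

Section Consumptions.
Variables (R : realType) (T L K A B : nat) (P : pricing_data R T L K A B).
Implicit Types (u v : 'M[bool]_(T, L)) (k : 'I_K) (a : 'I_A) (b : 'I_B).

Definition supp u : {set 'I_T * 'I_L} := [set p | u p.1 p.2].

Definition indicator (X : {set 'I_T * 'I_L}) : 'M[bool]_(T, L) :=
  \matrix_(t, l) ((t, l) \in X).

Lemma indicatorK : cancel indicator supp.
Proof. by move=> X; apply/setP => -[t l]; rewrite inE mxE. Qed.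

Lemma sum_supp (S : nmodType) (g : 'I_T * 'I_L -> S) u :
  \sum_(p in supp u) g p = \sum_t \sum_l g (t, l) *+ u t l.
Proof.
rewrite pair_bigA big_mkcond /=; apply: eq_bigr => -[t l] _.
by rewrite inE mulrb.
Qed.

(** Puts [F] in the form that [supporting_prices] handles: subsets of an allowed set with prescribed
    cardinality. *)
Lemma mem_F k a u :
  (u \in F P k a) = (supp u \subset ~: J P k a) && (#|supp u| == request P k a).
Proof.
rewrite inE andbC; congr (_ && _).
  apply/forall_inP/subsetP => uJ p.
    by rewrite in_setC inE => up; apply/negP => /uJ; rewrite up.
  move=> pJ; apply/eqP/negP => up.
  by have := uJ p; rewrite in_setC pJ inE => /(_ up).
rewrite -sum1_card (sum_supp (S := nat)); congr (_ == _).
by apply: eq_bigr => t _; apply: eq_bigr => l _; case: (u t l).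
Qed.

(** Infinite coefficients off the support are harmless since [-oo * 0 = 0]. *)
Lemma scalar_product_supp (c : 'I_T -> 'I_L -> \bar R) (r : 'I_T * 'I_L -> R)
    u :
  (forall p, p \in supp u -> c p.1 p.2 = (r p)%:E) ->
  scalar_product c u = (\sum_(p in supp u) r p)%:E.
Proof.
move=> cr; rewrite sum_supp /scalar_product -sumEFin; apply: eq_bigr => t _.
rewrite -sumEFin; apply: eq_bigr => l _; have := cr (t, l); rewrite inE /=.
by case: (u t l) => [-> //|_]; rewrite ?mule1 ?mule0.
Qed.

(** Real-valued substitute for [rho], with which it agrees off [J]. *)
Definition rel_pref k a (p : 'I_T * 'I_L) : R := pref P k a p.1 / sens P k a.

Lemma rho_supp k a u p : supp u \subset ~: J P k a -> p \in supp u ->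
  rho P k a p.1 p.2 = (rel_pref k a p)%:E.
Proof.
by move=> /subsetP uJ /uJ; rewrite in_setC /rho -surjective_pairing => ->.
Qed.

Lemma scalar_product_rho k a u : u \in F P k a ->
  scalar_product (rho P k a) u = (\sum_(p in supp u) rel_pref k a p)%:E.
Proof.
rewrite mem_F => /andP[uJ _].
by apply: scalar_product_supp => p /(rho_supp uJ).
Qed.

Lemma scalar_product_rho_price k a (y : 'M[R]_(T, L)) u : u \in F P k a ->
  scalar_product (fun t l => rho P k a t l + (y t l)%:E)%E u =
  (\sum_(p in supp u) (rel_pref k a p + y p.1 p.2))%:E.
Proof.
rewrite mem_F => /andP[uJ _].
by apply: scalar_product_supp => p /(rho_supp uJ) ->.
Qed.

(** The feasible families are finite in number and one exists; [finfun] turns them into elements of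
    a finite type. *)
Lemma step2_optimal_exists a b (N : 'M[nat]_(T, L)) :
  in_Minkowski_sum P a b N ->
  exists v : 'I_K -> 'M[bool]_(T, L), step2_optimal P a b N v.
Proof.
case=> v0 v0F Nv0.
pose feas (v : {ffun 'I_K -> 'M[bool]_(T, L)}) :=
  [forall k in customers P b, v k \in F P k a] && (aggregate P b v == N).
pose obj (v : {ffun 'I_K -> 'M[bool]_(T, L)}) :=
  (\sum_(k in customers P b) scalar_product (rho P k a) (v k))%E.
have aggE (v : 'I_K -> 'M[bool]_(T, L)) :
    aggregate P b (finfun v) = aggregate P b v.
  by apply/matrixP => t l; rewrite !mxE; apply: eq_bigr => k _; rewrite ffunE.
have feasP (v : 'I_K -> 'M[bool]_(T, L)) :
    (forall k, k \in customers P b -> v k \in F P k a) -> aggregate P b v = N ->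
    feas (finfun v).
  move=> vF aggv; rewrite /feas aggE aggv eqxx andbT.
  by apply/forall_inP => k kb; rewrite ffunE vF.
have feas0 := feasP v0 v0F (esym Nv0).
case: (@arg_maxP _ _ _ (finfun v0) feas obj feas0) => v.
move=> /andP[/forall_inP vF /eqP aggv] vmax.
exists v; split=> // v' [v'F aggv']; have := vmax _ (feasP v' v'F aggv').
have objE : obj (finfun v') =
    (\sum_(k in customers P b) scalar_product (rho P k a) (v' k))%E.
  by apply: eq_bigr => k _; rewrite ffunE.
by rewrite objE.
Qed.

(** An instance of [supporting_prices]: the agents are the customers with contract [b], the goods
    are the pairs [(t, l)], and the complement of [J] is allowed. *)
Lemma step3_solution_exists a b (N : 'M[nat]_(T, L))
    (u : 'I_K -> 'M[bool]_(T, L)) :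
  step2_optimal P a b N u ->
  exists y : 'M[R]_(T, L), nonneg y /\ step3_solution P a b u y.
Proof.
move=> [[uF aggu] umax].
have uF' k : k \in customers P b ->
    (supp (u k) \subset ~: J P k a) /\ #|supp (u k)| = request P k a.
  by move/uF; rewrite mem_F => /andP[? /eqP].
have [|v vP vsum|y [y_ge0 yP]] := @supporting_prices R _ _ (customers P b)
  (fun k => ~: J P k a) (fun k => rel_pref k a) (fun k => supp (u k)).
- by move=> k /uF'[].
- pose v' k := indicator (v k).
  have v'F k : k \in customers P b -> v' k \in F P k a.
    move=> kb; have [vJ cardv] := vP k kb; have [_ cardu] := uF' k kb.
    by rewrite mem_F indicatorK vJ cardv cardu eqxx.
  have aggv' : aggregate P b v' = N.
    rewrite -aggu; apply/matrixP => t l; rewrite !mxE.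
    under eq_bigr do rewrite mxE.
    by rewrite (vsum (t, l)); apply: eq_bigr => k _; rewrite inE.
  have := umax v' (conj v'F aggv').
  under eq_bigr => k kb do rewrite (scalar_product_rho (v'F k kb)) indicatorK.
  under [X in (_ <= X)%O]eq_bigr => k kb do
    rewrite (scalar_product_rho (uF k kb)).
  by rewrite !sumEFin lee_fin.
exists (\matrix_(t, l) y (t, l)); split=> [t l|k kb]; first by rewrite mxE.
split=> [|v vF]; first exact: uF.
rewrite !scalar_product_rho_price ?uF // lee_fin.
move: (vF); rewrite mem_F => /andP[vJ /eqP cardv]; have [_ cardu] := uF' k kb.
have := yP k (supp v) kb vJ; rewrite cardv cardu => /(_ erefl).
by congr (_ <= _); apply: eq_bigr => p _; rewrite mxE -surjective_pairing.
Qed.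

(** * The customer's problem, application by application *)

Lemma embed_F k a (w : {ffun 'I_T -> bool}) :
  (embed P k w \in F P k a) =
  (\sum_t w t == request P k a)%N && [forall t in forbidden P k a, ~~ w t].
Proof.
rewrite inE; congr (_ && _).
  congr (_ == _); apply: eq_bigr => t _.
  rewrite (bigD1 (traj P k t)) //= mxE eqxx andbT big1 ?addn0 // => l lt.
  by rewrite mxE [_ == l]eq_sym (negPf lt) andbF.
apply/forall_inP/forall_inP => [wJ t tI|wI [t l]].
  have := wJ (t, traj P k t); rewrite inE tI mxE eqxx andbT eqbF_neg.
  exact.
rewrite inE mxE /= eqbF_neg => /orP[/wI/negPf-> //|].
by rewrite eq_sym => /negPf ->; rewrite andbF.
Qed.

Lemma embed_surj k a u : u \in F P k a ->
  embed P k [ffun t => u t (traj P k t)] = u.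
Proof.
rewrite inE => /andP[_ /forall_inP uJ]; apply/matrixP => t l; rewrite mxE ffunE.
have [<-|tl] := eqVneq; first by rewrite andbT.
rewrite andbF; have /(_ _)/eqP-> // := uJ (t, l).
by rewrite inE /= eq_sym tl orbT.
Qed.

(** Factoring out the sensitivity turns preferences into the normalized ones of [rho], at the price
    of a positive factor per application. *)
Lemma customer_value_supp k (y : 'I_A -> 'M[R]_(T, L))
    (w : 'I_A -> {ffun 'I_T -> bool}) :
  customer_value P k y w = \sum_a sens P k a *
    \sum_(p in supp (embed P k (w a))) (rel_pref k a p + y a p.1 p.2).
Proof.
apply: eq_bigr => a _; rewrite sum_supp mulr_sumr; apply: eq_bigr => t _.
rewrite (bigD1 (traj P k t)) //= big1 ?addr0 => [|l lt]; last first.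
  by rewrite mxE [_ == l]eq_sym (negPf lt) andbF.
rewrite mxE eqxx andbT /rel_pref /= mulr_natr mulrnAr mulrDr.
by rewrite [X in _ = (X + _) *+ _]mulrC divfK // gt_eqF ?sens_gt0.
Qed.

Hypothesis disjoint_applications : forall k (a a' : 'I_A), a != a' ->
  [disjoint ~: forbidden P k a & ~: forbidden P k a'].

(** Disjointness enters here: two applications served at the same time would both have to allow it,
    so the constraint coupling applications is automatic. *)
Lemma customer_feasible_F k (w : 'I_A -> {ffun 'I_T -> bool}) :
  customer_feasible P k w <-> forall a, embed P k (w a) \in F P k a.
Proof.
split=> [[wR _ wI] a|wF].
  rewrite embed_F wR eqxx; apply/forall_inP => t /wI -> //.
have wI a t : t \in forbidden P k a -> w a t = false.
  by have := wF a; rewrite embed_F => /andP[_ /forall_inP h] /h /negbTE.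
split=> // [a|t]; first by have := wF a; rewrite embed_F => /andP[/eqP].
have [a wat|w0] := pickP (fun a => w a t); last first.
  by rewrite big1 // => a _; rewrite w0.
rewrite (bigD1 a) //= wat big1 // => a' aa'.
have /disjointFr := disjoint_applications k aa' => /(_ t).
rewrite !in_setC; case: (boolP (w a' t)) => // wa't.
case: (boolP (t \in forbidden P k a')) => [/wI|_ /(_ isT)].
  by rewrite wa't.
by move/negbFE/wI; rewrite wat.
Qed.

(** The feasible set is a product over applications and the value a positively weighted sum, so
    optima of the factors combine. *)
Lemma customer_optimal k (y : 'I_A -> 'M[R]_(T, L))
    (w : 'I_A -> {ffun 'I_T -> bool}) :
  (forall a, optimal (fun v => v \in F P k a)
    (scalar_product (fun t l => rho P k a t l + (y a t l)%:E)%E)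
    (embed P k (w a))) ->
  optimal (customer_feasible P k) (customer_value P k y) w.
Proof.
move=> wopt; have wF a : embed P k (w a) \in F P k a by case: (wopt a).
split=> [|w' /customer_feasible_F w'F]; first exact/customer_feasible_F.
rewrite !customer_value_supp; apply: ler_sum => a _.
rewrite ler_pM2l ?sens_gt0 // -lee_fin -!scalar_product_rho_price //.
by case: (wopt a) => _; apply.
Qed.

End Consumptions.

(** * Correctness of the three steps *)

Theorem theorem9 (R : realType) (T L K A B : nat)
    (P : pricing_data R T L K A B)
    (disjoint_applications : forall (k : 'I_K) (a a' : 'I_A), a != a' ->
      [disjoint ~: forbidden P k a & ~: forbidden P k a'])
    (N : 'I_A -> 'I_B -> 'M[nat]_(T, L))
    (N_optimal : step1_optimal P N) :
  (forall a b, exists v : 'I_K -> 'M[bool]_(T, L),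
     step2_optimal P a b (N a b) v) /\
  (forall u : 'I_K -> 'I_A -> 'M[bool]_(T, L),
     (forall a b, step2_optimal P a b (N a b) (fun k => u k a)) ->
     (forall a b, exists y : 'M[R]_(T, L),
        nonneg y /\ step3_solution P a b (fun k => u k a) y) /\
     (forall y : 'I_A -> 'I_B -> 'M[R]_(T, L),
        (forall a b, nonneg (y a b) /\
                     step3_solution P a b (fun k => u k a) (y a b)) ->
        exists w : 'I_K -> 'I_A -> {ffun 'I_T -> bool},
          (forall k a, embed P k (w k a) = u k a) /\
          bilevel_optimal P y w)).
Proof.
have [[N_sum N_cap] N_max] := N_optimal.
split=> [a b|u u_opt]; first exact: step2_optimal_exists.
split=> [a b|y y_sol]; first exact: step3_solution_exists (u_opt a b).
have own k : k \in customers P (Defs.contract P k) by rewrite inE.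
have uF k a : u k a \in F P k a.
  by have [[uF _] _] := u_opt a (Defs.contract P k); apply: uF.
pose w k a := [ffun t => u k a t (traj P k t)].
have wE k a : embed P k (w k a) = u k a by apply: embed_surj.
exists w; split=> //.
(* The aggregate constraint of step 2 makes the responses reproduce [N], so they attain the step 1
   value. *)
have countE : consumption_counts P w =2 N.
  move=> a b; have [[_ <-] _] := u_opt a b.
  by apply/matrixP => t l; rewrite !mxE; apply: eq_bigr => k _; rewrite wE.
have totalE : total_count (consumption_counts P w) =2 total_count N.
  by move=> t l; apply: eq_bigr => a _; apply: eq_bigr => b _; rewrite countE.
have valueE : provider_value P (consumption_counts P w) = provider_value P N.
  by do 4![apply: eq_bigr => ? _]; rewrite countE totalE.
split=> [|[y' w'] [/= _ w'_opt w'_cap]].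
  split=> [a b|k|t l]; first by case: (y_sol a b).
    apply: customer_optimal => // a; rewrite wE.
    by have [_] := y_sol a (Defs.contract P k); apply.
  by rewrite totalE.
(* Feasibility of any competing responses makes their counts admissible in step 1, whatever the
   prices. *)
rewrite /= valueE; apply: N_max; split=> // a b.
exists (fun k => embed P k (w' k a)) => // k _.
have [/(customer_feasible_F disjoint_applications) w'F _] := w'_opt k.
exact: w'F.
Qed.
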